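(* Let $(F_n)_{n\in\mathbb{N}}$ be a sequence of holomorphic self-maps of $\mathbb{D}$ such that $F_n(0)=0$ for all $n\in\mathbb{N}$, and suppose that $(I_n)$ is a shrinking target in $\partial\mathbb{D}$ such that \[ \sum_{n=1}^\infty |I_n|<\infty . \] Then $(F_n(\zeta))$ fails to hit $(I_n)$ for almost all $\zeta\in\partial\mathbb{D}$.
   Context: $\mathbb{D}=\{z\in\mathbb{C}:|z|<1\}$. A holomorphic map $F:\mathbb{D}\to\mathbb{D}$ has radial limits at almost every point of $\partial\mathbb{D}$ (with respect to arc length); this radial boundary extension, defined almost everywhere on $\partial\mathbb{D}$ with values in $\overline{\mathbb{D}}$, is denoted by the same letter $F$. ''Almost all'' refers to arc length (Lebesgue) measure on $\partial\mathbb{D}$. A target is a sequence $(I_n)_{n\in\mathbb{N}}$ of arcs of $\partial\mathbb{D}$, not necessarily nested and not necessarily shrinking in length; it is a shrinking target if $|I_n|\to0$ as $n\to\infty$, where $|I_n|$ is the length of $I_n$. For $\zeta\in\partial\mathbb{D}$, the sequence $(F_n(\zeta))$ hits the target $(I_n)$ if $F_n(\zeta)\in I_n$ for infinitely many $n$, that is, $\zeta\in\bigcap_{N=1}^\infty\bigcup_{n=N}^\infty F_n^{-1}(I_n)$; otherwise it fails to hit $(I_n)$. *)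

(* Defs.v *)
From HB Require Import structures.
From mathcomp Require Import all_boot all_order all_algebra.
From mathcomp Require Import all_classical all_reals all_analysis.
From mathcomp Require Import complex.

Set Implicit Arguments.
Unset Strict Implicit.
Unset Printing Implicit Defensive.

Import Order.TTheory GRing.Theory Num.Theory.
Import numFieldNormedType.Exports.

Local Open Scope classical_set_scope.
Local Open Scope ring_scope.
Local Open Scope complex_scope.

(* The complex plane is R[i]; R[i]^o is R[i] as a normed module over itself: it carries the usual topology
   of the plane, and derivability over it in direction 1 is complex
   differentiability. *)

Definition unit_disc (R : realType) : set R[i] := [set z | `|z| < 1].

Definition holomorphic_on (R : realType) (D : set R[i]) (F : R[i] -> R[i]) :
    Prop :=
  forall z, D z -> derivable (F : R[i]^o -> R[i]^o) z 1.

(* Functions are total; only the values of F on the open disc matter. *)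
Definition holomorphic_self_map (R : realType) (F : R[i] -> R[i]) : Prop :=
  holomorphic_on (@unit_disc R) F /\
  (forall z, unit_disc z -> unit_disc (F z)).

Definition expi (R : realType) (t : R) : R[i] := cos t +i* sin t.

Definition angles (R : realType) (A : set R[i]) : set R :=
  `[0, 2 * pi[ `&` @expi R @^-1` A.

(* t |-> expi t is a unit-speed bijection from [0, 2 pi[ onto the circle, so arc
   length is the image of Lebesgue measure under it. *)
Definition arc_length (R : realType) (A : set R[i]) : \bar R :=
  lebesgue_measure (angles A).

Definition almost_all_circle (R : realType) (P : R[i] -> Prop) : Prop :=
  {ae @lebesgue_measure R, forall t, t \in `[0, 2 * pi[ -> P (expi t)}.

(* Open, closed and half-open arcs, the whole circle and single points. *)
Definition is_arc (R : realType) (A : set R[i]) : Prop :=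
  exists J : set R, [/\ is_interval J, J !=set0 & A = @expi R @` J].

(* The graph of the radial boundary extension of F, a partial function on the
   circle. *)
Definition radial_limit (R : realType) (F : R[i] -> R[i]) (zeta w : R[i]) :
    Prop :=
  (F (r%:C * zeta) : R[i]^o) @[r --> (1 : R)^'-] --> (w : R[i]^o).

(* The preimage of A under the radial boundary extension of F. *)
Definition boundary_preimage (R : realType) (F : R[i] -> R[i]) (A : set R[i]) :
    set R[i] :=
  [set zeta | `|zeta| = 1 /\ exists2 w, radial_limit F zeta w & A w].

Definition target (R : realType) (I : nat -> set R[i]) : Prop :=
  forall n, is_arc (I n).

Definition shrinking_target (R : realType) (I : nat -> set R[i]) : Prop :=
  target I /\ arc_length (I n) @[n --> \oo] --> 0%E.

Definition hits (R : realType) (F : nat -> R[i] -> R[i])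
    (I : nat -> set R[i]) (zeta : R[i]) : Prop :=
  lim_sup_set (fun n => boundary_preimage (F n) (I n)) zeta.

Definition fails_to_hit (R : realType) (F : nat -> R[i] -> R[i])
    (I : nat -> set R[i]) (zeta : R[i]) : Prop :=
  ~ hits F I zeta.

(* Main.v *)
Require Import Defs.
From HB Require Import structures.
From mathcomp Require Import all_boot all_order all_algebra.
From mathcomp Require Import all_classical all_reals all_analysis.
From mathcomp Require Import complex.
From mathcomp Require Import measurable_realfun.
From mathcomp Require Import ring lra.
Import Order.TTheory GRing.Theory Num.Theory.
Import numFieldNormedType.Exports.
Local Open Scope classical_set_scope.
Local Open Scope ring_scope.
Local Open Scope complex_scope.

(* Borel-Cantelli reduces the claim to a bound for the length of the preimage of
   a single arc, linear in the radius [d] of a disc about a point [w0] of the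
   circle that contains the arc.  Put [p = (1 + d) w0].  The function
   [re (p / (p - F z))] is positive on the disc, has mean value 1 over each
   circle about 0 because [F 0 = 0], and is at least [1 / (9 d)] as soon as
   [F z] is within [2 d] of [w0].  By Markov's inequality the angles at which
   this happens have measure at most [18 pi d] on every circle, hence so do the
   angles at which it eventually happens along radii.

   Only pointwise complex differentiability is assumed, so the mean value
   property goes through Goursat's bisection argument.  It is applied to
   [G (exp (s + i t))] on rectangles [s0, s1] x [0, 2 pi]: the sides [t = 0] and
   [t = 2 pi] cancel by periodicity, so the circle means do not depend on [s],
   and they tend to [2 pi re (G 0)] as [s] goes to minus infinity. *)

(** * Goursat's lemma *)

Lemma nested_intervals_point {R : realType} (a b : nat -> R) :
  (forall n, a n <= a n.+1) -> (forall n, b n.+1 <= b n) ->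
  (forall n, a n <= b n) -> exists x, forall n, a n <= x <= b n.
Proof.
move=> ia db ab.
have am m n : (m <= n)%N -> a m <= a n by move: m n; exact/nondecreasing_seqP.
have bm m n : (m <= n)%N -> b n <= b m by move: m n; exact/nonincreasing_seqP.
have abmn m n : a m <= b n.
  have [mn|/ltnW nm] := leqP m n; first exact: le_trans (am _ _ mn) (ab n).
  exact: le_trans (ab m) (bm _ _ nm).
exists (sup (range a)) => n; apply/andP; split.
  apply: ub_le_sup; last by exists n.
  by exists (b 0%N) => _ [m _ <-].
apply: ge_sup; first by exists (a 0%N); exists 0%N.
by move=> _ [m _ <-].
Qed.

(** A surviving quarter is chosen again and again; the rectangles are nested and halve in each
    direction, so they close in on one point. *)
Lemma quadrisection_point {R : realType} {P : R -> R -> R -> R -> Prop}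
    {x0 x1 y0 y1 : R} :
  x0 <= x1 -> y0 <= y1 -> P x0 x1 y0 y1 ->
  (forall a b c d, a <= b -> c <= d -> P a b c d ->
     let m := (a + b) / 2 in let n := (c + d) / 2 in
     [\/ P a m c n, P a m n d, P m b c n | P m b n d]) ->
  exists x y, [/\ x0 <= x <= x1, y0 <= y <= y1 &
    forall e, 0 < e -> exists a b c d, [/\ P a b c d,
      x0 <= a /\ b <= x1, y0 <= c /\ d <= y1, a <= x <= b /\ c <= y <= d
      & b - a < e /\ d - c < e]].
Proof.
move=> x01 y01 P0 quarter.
pose sub (r r' : R * R * (R * R)) :=
  let: ((a, b), (c, d)) := r in let: ((a', b'), (c', d')) := r' in
  [/\ P a' b' c' d', a <= a' /\ b' <= b, c <= c' /\ d' <= d,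
     b' - a' = (b - a) / 2 & d' - c' = (d - c) / 2].
(* The step is total: on a rectangle that is reversed or violates [P] it returns its input, which
   the guarded statement allows. *)
have /choice[step stepP] : forall r : R * R * (R * R), exists r',
    r.1.1 <= r.1.2 -> r.2.1 <= r.2.2 ->
    P r.1.1 r.1.2 r.2.1 r.2.2 -> sub r r'.
  move=> [[a b] [c d]] /=.
  have [ab|] := boolP (a <= b); last by exists (a, b, (c, d)).
  have [cd|] := boolP (c <= d); last by exists (a, b, (c, d)).
  have [/(quarter _ _ _ _ ab cd) H|] := pselect (P a b c d); last first.
    by exists (a, b, (c, d)).
  case: H => H.
  - by exists (a, (a + b) / 2, (c, (c + d) / 2)) => _ _ _; split=> //; lra.
  - by exists (a, (a + b) / 2, ((c + d) / 2, d)) => _ _ _; split=> //; lra.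
  - by exists ((a + b) / 2, b, (c, (c + d) / 2)) => _ _ _; split=> //; lra.
  - by exists ((a + b) / 2, b, ((c + d) / 2, d)) => _ _ _; split=> //; lra.
pose r n := iter n step (x0, x1, (y0, y1)).
pose a n := (r n).1.1; pose b n := (r n).1.2.
pose c n := (r n).2.1; pose d n := (r n).2.2.
have inv n : [/\ P (a n) (b n) (c n) (d n), a n <= b n & c n <= d n].
  elim: n => [//|n [Pn abn cdn]].
  have := stepP (r n) abn cdn Pn.
  rewrite -[step (r n)]/(r n.+1).
  rewrite /sub; rewrite /a /b /c /d in Pn abn cdn *.
  case: (r n) Pn abn cdn => [[? ?] [? ?]] /= Pn abn cdn.
  case: (step (r n)) => [[? ?] [? ?]] /= [? ? ? ? ?]; split=> //; lra.
have sb n : sub (r n) (r n.+1) by have [Pn an cn] := inv n; exact: stepP.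
have nest n : [/\ a n <= a n.+1, b n.+1 <= b n, c n <= c n.+1 & d n.+1 <= d n].
  have := sb n; rewrite /sub /a /b /c /d.
  case: (r n) => [[? ?] [? ?]]; case: (r n.+1) => [[? ?] [? ?]] /= [_ [? ?] [? ?] _ _].
  by split.
have len n : b n - a n = (x1 - x0) / 2 ^+ n /\ d n - c n = (y1 - y0) / 2 ^+ n.
  elim: n => [|n [IHx IHy]]; first by rewrite /a /b /c /d /= expr0 !divr1.
  have : b n.+1 - a n.+1 = (b n - a n) / 2 /\ d n.+1 - c n.+1 = (d n - c n) / 2.
    have := sb n; rewrite /sub /a /b /c /d.
    by case: (r n) => [[? ?] [? ?]]; case: (r n.+1) => [[? ?] [? ?]] /= [].
  by rewrite IHx IHy exprSr invfM !mulrA.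
have [x xab] : exists x, forall n, a n <= x <= b n.
  by apply: nested_intervals_point => n; have [] := nest n; have [] := inv n.
have [y ycd] : exists y, forall n, c n <= y <= d n.
  by apply: nested_intervals_point => n; have [] := nest n; have [] := inv n.
exists x, y; split; [exact: (xab 0%N)|exact: (ycd 0%N)|move=> e e0].
have bnd n : [/\ x0 <= a n, b n <= x1, y0 <= c n & d n <= y1].
  elim: n => [|n]; first by rewrite /a /b /c /d /=.
  by move=> [? ? ? ?]; have [? ? ? ?] := nest n; split; lra.
(* [K] bounds both initial sides; [n > K / e] suffices because [n < 2 ^ n]. *)
pose K := (x1 - x0) + (y1 - y0).
have [n Kn] : exists n, K / 2 ^+ n < e.
  have [n ltn] : exists n : nat, K / e < n%:R.
    by exists (Num.truncn (K / e)).+1; exact: truncnS_gt.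
  exists n; rewrite ltr_pdivrMr ?exprn_gt0// -ltr_pdivrMl// mulrC.
  by rewrite (lt_le_trans ltn)// -natrX ler_nat ltnW// ltn_expl.
exists (a n), (b n), (c n), (d n).
have [Pn _ _] := inv n; have [? ? ? ?] := bnd n; have [-> ->] := len n.
split=> //; split=> //; apply: le_lt_trans Kn;
  rewrite ler_pM2r ?invr_gt0 ?exprn_gt0// /K; lra.
Qed.

(** Real differentiability at [(x, y)] with gradient [(a, b)], as an explicit remainder bound in the
    l1 norm, ready for integral estimates. *)
Definition diff2 {R : realType} (f : R -> R -> R) (x y a b : R) :=
  forall e, 0 < e -> exists2 d, 0 < d & forall x' y',
    `|x' - x| <= d -> `|y' - y| <= d ->
    `|f x' y' - f x y - (a * (x' - x) + b * (y' - y))|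
      <= e * (`|x' - x| + `|y' - y|).

Lemma diff2_swap {R : realType} {f : R -> R -> R} {x y a b : R} :
  diff2 f x y a b -> diff2 (fun y x => f x y) y x b a.
Proof.
move=> df e /df[d d0 dP]; exists d => // y' x' yd xd.
by rewrite (addrC (b * _)) (addrC `|y' - y|) dP.
Qed.

Lemma diff2_continuous {R : realType} {f : R -> R -> R} {x y a b : R} :
  diff2 f x y a b -> {for y, continuous (f x)}.
Proof.
move=> df; apply/cvgrPdist_le => /= e e0.
(* Tolerance 1 gives the Lipschitz constant [|b| + 1] at [y]. *)
have [d d0 dP] := df 1 ltr01.
have K0 : 0 < `|b| + 1 by rewrite ltr_wpDl.
have nearr r : 0 < r -> \forall y' \near y, `|y' - y| <= r.
  by move=> r0; apply/nbhs_ballP; exists r => //= z; rewrite /ball/= distrC => /ltW.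
near=> y'.
have yd : `|y' - y| <= d by near: y'; exact: nearr.
have ye : `|y' - y| <= e / (`|b| + 1) by near: y'; apply: nearr; rewrite divr_gt0.
have := dP x y' _ yd; rewrite subrr normr0 mulr0 !add0r mul1r => /(_ (ltW d0)) h.
rewrite distrC -(subrK (b * (y' - y)) (f x y' - f x y)).
rewrite (le_trans (ler_normD _ _))// normrM.
rewrite (le_trans (lerD h (lexx _)))// -{1}(mul1r `|y' - y|) -mulrDl.
by rewrite addrC mulrC -ler_pdivlMr.
Unshelve. all: by end_near.
Qed.

Section interval_integral.
Context {R : realType}.
Notation mu := (@lebesgue_measure R).
Implicit Types (f g : R -> R) (a b c : R).

Definition cont_on a b f := forall x, a <= x <= b -> {for x, continuous f}.

Lemma cont_on_integrable {a b f} :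
  cont_on a b f -> mu.-integrable `[a, b] (EFin \o f).
Proof.
move=> cf; apply: continuous_compact_integrable; first exact: segment_compact.
apply: continuous_in_subspaceT => x; rewrite inE/= in_itv/= => xab; exact: cf.
Qed.

Lemma Rintegral_split {c a b f} : a <= c <= b -> cont_on a b f ->
  \int[mu]_(x in `[a, b]) f x
    = \int[mu]_(x in `[a, c]) f x + \int[mu]_(x in `[c, b]) f x.
Proof.
move=> /andP[ac cb] cf; have fi := cont_on_integrable cf.
have := @Rintegral_itvB R f (BLeft a) (BRight b) c fi.
rewrite !bnd_simp => /(_ ac cb) E.
apply/eqP; rewrite addrC -subr_eq E Rintegral_itv_obnd_cbnd//.
apply: integrableS fi => //; apply: subset_itvr.
by rewrite bnd_simp.
Qed.

Lemma Rintegral_near_cst a b f k e : a <= b -> cont_on a b f ->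
  (forall x, a <= x <= b -> `|f x - k| <= e) ->
  `|\int[mu]_(x in `[a, b]) f x - k * (b - a)| <= e * (b - a).
Proof.
move=> ab cf fk.
have fi := cont_on_integrable cf.
have ci r : mu.-integrable `[a, b] (EFin \o (fun=> r)).
  by apply: cont_on_integrable => x _; exact: cvg_cst.
have cE r : \int[mu]_(x in `[a, b]) r = r * (b - a).
  rewrite Rintegral_cst//= lebesgue_measure_itv/= lte_fin.
  by case: ltgtP ab => // -> _; rewrite subrr.
have iB : mu.-integrable `[a, b] (EFin \o (fun x => f x - k)).
  by apply: cont_on_integrable => x /cf cx; apply: cvgB => //; exact: cvg_cst.
rewrite -(cE k) -RintegralB//.
rewrite -(cE e) (le_trans (le_normr_Rintegral _ _))//.
apply: le_Rintegral => //.
apply: cont_on_integrable => x /cf cx; apply: cvg_norm.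
by apply: cvgB => //; exact: cvg_cst.
Qed.

End interval_integral.

Section goursat.
Context {R : realType}.
Notation mu := (@lebesgue_measure R).
Variables U V : R -> R -> R.

(* The integral of the 1-form [U dy + V dx] along the boundary of a rectangle. *)
Definition boundary_integral (x0 x1 y0 y1 : R) : R :=
  \int[mu]_(y in `[y0, y1]) U x1 y - \int[mu]_(y in `[y0, y1]) U x0 y
  - (\int[mu]_(x in `[x0, x1]) V x y1 - \int[mu]_(x in `[x0, x1]) V x y0).

(** The shared [a] is the equation [U_x = V_y], which says that [U dy + V dx] is closed. *)
Let cauchy_riemann x y := exists a b c, diff2 U x y a b /\ diff2 V x y c a.

(** To first order the two pairs of opposite sides each give [U_x = V_y] times the area, and these
    cancel; only remainders of size [e] times length squared are left. *)
Lemma boundary_integral_local {x y e : R} : cauchy_riemann x y -> 0 < e ->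
  exists2 d, 0 < d & forall a b c k,
    (forall x y, a <= x <= b -> c <= y <= k -> cauchy_riemann x y) ->
    a <= x <= b -> c <= y <= k -> b - a < d -> k - c < d ->
  `|boundary_integral a b c k| <= e * (b - a + (k - c)) ^+ 2.
Proof.
move=> [p [q [s [dU dV]]]] e0.
have e20 : 0 < e / 2 by rewrite divr_gt0.
have [d1 d10 d1P] := dU _ e20.
have [d2 d20 d2P] := dV _ e20.
exists (Num.min d1 d2); first by rewrite lt_min d10.
move=> a b c k CR xab yck; rewrite !lt_min => /andP[ab1 ab2] /andP[ck1 ck2].
have cUx x' : a <= x' <= b -> cont_on c k (U x').
  move=> x'ab y' y'ck; have [? [? [? [h _]]]] := CR _ _ x'ab y'ck.
  exact: diff2_continuous h.
have cVy y' : c <= y' <= k -> cont_on a b (V ^~ y').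
  move=> y'ck x' x'ab; have [? [? [? [_ h]]]] := CR _ _ x'ab y'ck.
  exact: diff2_continuous (diff2_swap h).
have [xa xb] := andP xab; have [yc yk] := andP yck.
have ab : a <= b by exact: le_trans xb.
have ck : c <= k by exact: le_trans yk.
have aab : a <= a <= b by rewrite lexx.
have bab : a <= b <= b by rewrite lexx ab.
have cck : c <= c <= k by rewrite lexx.
have kck : c <= k <= k by rewrite lexx ck.
have nx x' : a <= x' <= b -> `|x' - x| <= b - a by rewrite ler_norml; lra.
have ny y' : c <= y' <= k -> `|y' - y| <= k - c by rewrite ler_norml; lra.
have small x' y' : a <= x' <= b -> c <= y' <= k ->
    `|U x' y' - U x y - (p * (x' - x) + q * (y' - y))| <= e / 2 * (b - a + (k - c)) /\
    `|V x' y' - V x y - (s * (x' - x) + p * (y' - y))| <= e / 2 * (b - a + (k - c)).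
  move=> /nx x'ab /ny y'ck.
  have S : e / 2 * (`|x' - x| + `|y' - y|) <= e / 2 * (b - a + (k - c)).
    by rewrite ler_pM2l// lerD.
  split; apply: le_trans S; [apply: d1P|apply: d2P];
    by rewrite (le_trans x'ab, le_trans y'ck) ?(ltW ab1, ltW ab2, ltW ck1, ltW ck2).
(* The terms in [q] agree on the two vertical sides, so the integrand is close to the constant
   [p * (b - a)]. *)
have IU : `|\int[mu]_(y in `[c, k]) (U b y - U a y) - p * (b - a) * (k - c)|
    <= e * (b - a + (k - c)) * (k - c).
  apply: Rintegral_near_cst => //.
    by move=> y' y'ck; apply: cvgB; [exact: cUx|exact: cUx].
  move=> y' y'ck; have [h1 _] := small b y' bab y'ck.
  have [h2 _] := small a y' aab y'ck.
  move: h1 h2; rewrite !ler_norml; lra.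
have IV : `|\int[mu]_(x in `[a, b]) (V x k - V x c) - p * (k - c) * (b - a)|
    <= e * (b - a + (k - c)) * (b - a).
  apply: Rintegral_near_cst => //.
    by move=> x' x'ab; apply: cvgB; [exact: cVy|exact: cVy].
  move=> x' x'ab; have [_ h1] := small x' k x'ab kck.
  have [_ h2] := small x' c x'ab cck.
  move: h1 h2; rewrite !ler_norml; lra.
rewrite /boundary_integral -RintegralB//; try exact/cont_on_integrable/cUx.
rewrite -RintegralB//; try exact/cont_on_integrable/cVy.
move: IU IV; rewrite (mulrAC p) !ler_norml expr2; nra.
Qed.

(** Some quarter always carries at least a quarter of the integral, so at scale [k] the integral
    stays at least [k ^ 2 * |w|], whereas differentiability at the limit point bounds it by an
    arbitrarily small multiple of [k ^ 2]. *)
Theorem goursat (x0 x1 y0 y1 : R) : x0 <= x1 -> y0 <= y1 ->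
  (forall x y, x0 <= x <= x1 -> y0 <= y <= y1 -> cauchy_riemann x y) ->
  boundary_integral x0 x1 y0 y1 = 0.
Proof.
move=> x01 y01 CR; set w := boundary_integral _ _ _ _.
pose X := x1 - x0; pose Y := y1 - y0.
have X0 : 0 <= X by rewrite subr_ge0.
have Y0 : 0 <= Y by rewrite subr_ge0.
(* [P] keeps copies of the original rectangle at scale [k]; the common ratio makes both sides of the
   final estimate scale by [k ^ 2]. *)
pose P a b c d := [/\ x0 <= a /\ b <= x1, y0 <= c /\ d <= y1 & exists2 k,
  0 < k /\ (b - a = k * X /\ d - c = k * Y) &
  k ^+ 2 * `|w| <= `|boundary_integral a b c d|].
have P0 : P x0 x1 y0 y1.
  by split=> //; exists 1; rewrite ?expr1n ?mul1r.
have quarter a b c d : a <= b -> c <= d -> P a b c d ->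
     let m := (a + b) / 2 in let n := (c + d) / 2 in
     [\/ P a m c n, P a m n d, P m b c n | P m b n d].
  move=> ab cd [[xa xb] [yc yd] [k [k0 [kX kY]] kw]] m n.
  have cU x : a <= x <= b -> cont_on c d (U x).
    move=> xab y ycd.
    have [||? [? [? [h _]]]] := CR x y; [lra|lra|exact: diff2_continuous h].
  have cV y : c <= y <= d -> cont_on a b (V ^~ y).
    move=> ycd x xab; have [||? [? [? [_ h]]]] := CR x y; [lra|lra|].
    exact: diff2_continuous (diff2_swap h).
  have mab : a <= m <= b by rewrite /m; lra.
  have ncd : c <= n <= d by rewrite /n; lra.
  have sU x : a <= x <= b -> _ := fun h => Rintegral_split ncd (cU x h).
  have sV y : c <= y <= d -> _ := fun h => Rintegral_split mab (cV y h).
  have E : boundary_integral a b c d = boundary_integral a m c n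
      + boundary_integral a m n d + boundary_integral m b c n
      + boundary_integral m b n d.
    rewrite /boundary_integral (sU a) ?lexx// (sU b) ?lexx ?ab//.
    by rewrite (sV c) ?lexx// (sV d) ?lexx ?cd//; lra.
  have k20 : 0 < k / 2 by rewrite divr_gt0.
  have K1 : m - a = k / 2 * X by rewrite mulrAC -kX /m; field.
  have K2 : b - m = k / 2 * X by rewrite mulrAC -kX /m; field.
  have K3 : n - c = k / 2 * Y by rewrite mulrAC -kY /n; field.
  have K4 : d - n = k / 2 * Y by rewrite mulrAC -kY /n; field.
  have small a' b' c' d' : x0 <= a' -> b' <= x1 -> y0 <= c' -> d' <= y1 ->
      b' - a' = k / 2 * X -> d' - c' = k / 2 * Y ->
      P a' b' c' d' \/ `|boundary_integral a' b' c' d'| < (k / 2) ^+ 2 * `|w|.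
    move=> ? ? ? ? ? ?.
    have [le|lt] := leP ((k / 2) ^+ 2 * `|w|) `|boundary_integral a' b' c' d'|.
      by left; split=> //; exists (k / 2).
    by right.
  have [am mb] := andP mab; have [cn nd] := andP ncd.
  have xm := le_trans xa am; have mx := le_trans mb xb.
  have yn := le_trans yc cn; have ny := le_trans nd yd.
  have [|h1] := small a m c n xa mx yc ny K1 K3; first by constructor 1.
  have [|h2] := small a m n d xa mx yn yd K1 K4; first by constructor 2.
  have [|h3] := small m b c n xm xb yc ny K2 K3; first by constructor 3.
  have [|h4] := small m b n d xm xb yn yd K2 K4; first by constructor 4.
  (* If all four quarters fell short, their sum would be less than [k ^ 2 * |w|]. *)
  exfalso; move: kw; rewrite E leNgt => /negP; apply.
  rewrite (le_lt_trans (ler_normD _ _))//.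
  rewrite (le_lt_trans (lerD (ler_normD _ _) (lexx _)))//.
  rewrite (le_lt_trans (lerD (lerD (ler_normD _ _) (lexx _)) (lexx _)))//.
  have -> : k ^+ 2 * `|w| = 4 * ((k / 2) ^+ 2 * `|w|) by field.
  lra.
have [x [y [xx yy near_xy]]] := quadrisection_point x01 y01 P0 quarter.
apply/normr0_eq0/eqP; rewrite eq_le normr_ge0 andbT.
apply/ler_addgt0Pr => e e0; rewrite add0r.
(* The summand 1 keeps the divisor positive when the rectangle is a point. *)
have S0 : 0 < (X + Y) ^+ 2 + 1 by rewrite ltr_wpDl// sqr_ge0.
have [d d0 dP] := boundary_integral_local (CR _ _ xx yy) (divr_gt0 e0 S0).
have [a [b [c [d' [Pabcd [xa xb] [yc yd] [xab ycd] [ba dc]]]]]] := near_xy d d0.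
have [_ _ [k [k0 [kX kY]] kw]] := Pabcd.
have CR' x' y' : a <= x' <= b -> c <= y' <= d' -> cauchy_riemann x' y'.
  by move=> ? ?; apply: CR; lra.
have := dP a b c d' CR' xab ycd ba dc.
have -> : b - a + (d' - c) = k * (X + Y) by rewrite kX kY -mulrDr.
move=> /(le_trans kw).
rewrite exprMn mulrCA ler_pM2l ?exprn_gt0// => /le_trans; apply.
by rewrite mulrAC ler_pdivrMr// ler_pM2l// lerDl.
Qed.

End goursat.

(** * Differentiability in logarithmic coordinates *)

Lemma derivable_expansion {K : numFieldType} {f : K^o -> K^o} {x : K} :
  derivable f x 1 -> forall e, 0 < e -> exists2 d, 0 < d & forall y,
    `|y - x| <= d -> `|f y - f x - 'D_1 f x * (y - x)| <= e * `|y - x|.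
Proof.
move=> df e e0.
have /cvgrPdist_le/(_ e e0) : (fun h => h^-1 *: ((f \o shift x) (h *: (1 : K^o)) - f x))
    @ 0^' --> 'D_1 f x by exact: df.
move=> /nbhs_ballP[d /= d0 dP]; exists (d / 2); first by rewrite divr_gt0.
move=> y yd; have [->|yx] := eqVneq y x.
  by rewrite !subrr mulr0 subrr normr0 mulr0.
have h0 : y - x != 0 by rewrite subr_eq0.
have := dP (y - x); rewrite /ball/= sub0r normrN => /(_ _ h0).
rewrite (le_lt_trans yd); last by rewrite ltr_pdivrMr// ltr_pMr// ltr1n.
move=> /(_ isT); rewrite /shift/= -[_ *: 1]/(_ * 1) mulr1 subrK.
move=> h; rewrite -ler_pdivrMr ?normr_gt0// -normfV -normrM.
rewrite mulrBl mulfK// distrC mulrC; exact: h.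
Qed.

Lemma diff2M {R : realType} {f g : R -> R} {x y : R} :
  derivable f x 1 -> derivable g y 1 ->
  diff2 (fun x y => f x * g y) x y ('D_1 f x * g y) (f x * 'D_1 g y).
Proof.
move=> /derivable_expansion df /derivable_expansion dg e e0.
set f' := 'D_1 f x; set g' := 'D_1 g y.
pose K := `|f x| + `|f'| + `|g y| + `|g'| + 2.
have fx0 := normr_ge0 (f x); have gy0 := normr_ge0 (g y).
have f'0 := normr_ge0 f'; have g'0 := normr_ge0 g'.
have K0 : 0 < K by rewrite /K; lra.
have K1 : 1 <= K by rewrite /K; lra.
have L0 : 0 < 2 * (K * K) by rewrite !mulr_gt0.
(* [e'] is both the tolerance of the two expansions and a bound for the increments, since the cross
   term in [h * k] has no other small factor. *)
have [e' [e'0 e'1 e'K]] : exists e', [/\ 0 < e', e' <= 1 & e' * (2 * (K * K)) <= e].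
  exists (Num.min 1 (e / (2 * (K * K)))); split.
  - by rewrite lt_min ltr01 divr_gt0.
  - by rewrite ge_min lexx.
  - by rewrite -ler_pdivlMr// ge_min lexx orbT.
have [d1 d10 d1P] := df _ e'0; have [d2 d20 d2P] := dg _ e'0.
pose d := Num.min (Num.min d1 d2) e'.
exists d; first by rewrite !lt_min d10 d20.
move=> x' y'; rewrite !le_min -!andbA => /and3P[/d1P xd _ xe] /and3P[_ /d2P yd ye].
set h := x' - x in xd xe *; set k := y' - y in yd ye *.
rewrite -/f' in xd; rewrite -/g' in yd.
have gy' : `|g y' - g y| <= K * `|k|.
  rewrite -(subrK (g' * k) (g y' - g y)) (le_trans (ler_normD _ _))// normrM.
  rewrite (le_trans (lerD yd (lexx _)))// -mulrDl ler_wpM2r// /K; lra.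
have gyK : `|g y'| <= K.
  rewrite -(subrK (g y) (g y')) (le_trans (ler_normD _ _))//.
  rewrite -(subrK (g' * k) (g y' - g y)) (le_trans (lerD (ler_normD _ _) (lexx _)))//.
  have k1 : `|k| <= 1 by exact: le_trans e'1.
  have : `|g' * k| <= `|g'| by rewrite normrM ler_piMr.
  have : e' * `|k| <= 1 by rewrite mulr_ile1 // ltW.
  by rewrite /K; lra.
have -> : f x' * g y' - f x * g y - (f' * g y * h + f x * g' * k) =
  (f x' - f x - f' * h) * g y' + f' * h * (g y' - g y)
  + f x * (g y' - g y - g' * k) by ring.
rewrite (le_trans (ler_normD _ _))// (le_trans (lerD (ler_normD _ _) (lexx _)))//.
rewrite !normrM.
have A : `|f x' - f x - f' * h| * `|g y'| <= e' * `|h| * K by exact: ler_pM.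
have B : `|f'| * `|h| * `|g y' - g y| <= K * `|h| * (K * e').
  apply: ler_pM => //; first by rewrite ler_wpM2r// /K; lra.
  by rewrite (le_trans gy')// ler_wpM2l// ltW.
have C : `|f x| * `|g y' - g y - g' * k| <= K * (e' * `|k|).
  by apply: ler_pM => //; rewrite /K; lra.
have KK : K <= K * K by rewrite ler_peMl// ltW.
have D : e' * `|h| * K <= e' * `|h| * (K * K) by rewrite ler_wpM2l// mulr_ge0// ltW.
have E : e' * `|k| * K <= e' * `|k| * (K * K) by rewrite ler_wpM2l// mulr_ge0// ltW.
have G : e' * (2 * (K * K)) * (`|h| + `|k|) <= e * (`|h| + `|k|).
  by rewrite ler_wpM2r// addr_ge0.
have : 0 <= e' * `|k| * (K * K) by rewrite !mulr_ge0 // ltW.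
move: A B C D E G; lra.
Qed.

Import ComplexField.Normc.
Local Notation re := complex.Re.
Local Notation im := complex.Im.

Section complex_log_coordinates.
Context {R : realType}.
Implicit Types (z w c : R[i]) (G : R[i] -> R[i]) (t x y : R).

Lemma normc_ge0 z : 0 <= normc z.
Proof. by case: z => a b; exact: sqrtr_ge0. Qed.

Lemma normc_le_ReIm z : normc z <= `|re z| + `|im z|.
Proof.
case: z => a b /=; rewrite -[leRHS]ger0_norm ?addr_ge0//.
rewrite -sqrtr_sqr ler_wsqrtr// sqrrD !real_normK ?num_real//.
by rewrite lerD2r lerDl mulrn_wge0// mulr_ge0.
Qed.

Lemma normRe_le z : `|re z| <= normc z.
Proof.
by case: z => a b /=; rewrite -sqrtr_sqr ler_wsqrtr// lerDl sqr_ge0.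
Qed.

Lemma normIm_le z : `|im z| <= normc z.
Proof.
by case: z => a b /=; rewrite -sqrtr_sqr ler_wsqrtr// lerDr sqr_ge0.
Qed.

Lemma normc_expi t : normc (expi t) = 1.
Proof. by rewrite /expi /= cos2Dsin2 sqrtr1. Qed.

(** Passes to the real-valued modulus [normc]: the norm of [R[i]] takes its values in [R[i]], and so
    do the tolerances of the general expansion. *)
Lemma complex_expansion {G z} : derivable (G : R[i]^o -> R[i]^o) z 1 ->
  exists c, forall e, 0 < e -> exists2 d : R, 0 < d & forall w,
    normc (w - z) <= d -> normc (G w - G z - c * (w - z)) <= e * normc (w - z).
Proof.
move=> /derivable_expansion dG; exists ('D_1 (G : R[i]^o -> R[i]^o) z) => e e0.
have [|[d d'] + dP] := dG (e%:C : R[i]); first by rewrite ltcR.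
rewrite ltcE/= => /andP[/eqP d'0 d0]; rewrite d'0 in dP; exists d => // w wz.
have := dP w; rewrite -[`|w - z|]/((normc (w - z))%:C) lecR => /(_ wz).
by rewrite -rmorphM -[X in X <= _]/((normc _)%:C) lecR.
Qed.

(** This is [exp (x + i y)]: the circle of radius [exp x] is traced as [y] varies. *)
Definition expc x y : R[i] := (expR x)%:C * expi y.

Lemma expcE x y : expc x y = (expR x * cos y) +i* (expR x * sin y).
Proof. by rewrite /expc /expi; simpc. Qed.

Lemma normc_expc x y : normc (expc x y) = expR x.
Proof.
by rewrite normcM normc_expi mulr1 /= expr0n addr0 sqrtr_sqr ger0_norm ?expR_ge0.
Qed.

Lemma expc_expansion x y e : 0 < e -> exists2 d, 0 < d & forall x' y',
  `|x' - x| <= d -> `|y' - y| <= d ->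
  normc (expc x' y' - expc x y - expc x y * ((x' - x) +i* (y' - y)))
    <= e * (`|x' - x| + `|y' - y|).
Proof.
move=> e0; have e20 : 0 < e / 2 by rewrite divr_gt0.
have dexp : derivable (@expR R) x 1 by exact: derivable_expR.
have dcos : derivable (@cos R) y 1 by exact: derivable_cos.
have dsin : derivable (@sin R) y 1 by exact: derivable_sin.
have [d1 d10 d1P] := diff2M dexp dcos _ e20.
have [d2 d20 d2P] := diff2M dexp dsin _ e20.
exists (Num.min d1 d2); first by rewrite lt_min d10.
move=> x' y'; rewrite !le_min => /andP[x1 x2] /andP[y1 y2].
have := d1P x' y' x1 y1; have := d2P x' y' x2 y2.
rewrite !derive_val => hIm hRe.
rewrite (le_trans (normc_le_ReIm _))// !expcE.
apply: le_trans (lerD (le_trans _ hRe) (le_trans _ hIm)) _; last lra.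
- by rewrite le_eqVlt; apply/orP; left; apply/eqP; congr `|_|; simpc => /=; ring.
- by rewrite le_eqVlt; apply/orP; left; apply/eqP; congr `|_|; simpc => /=; ring.
Qed.

(** Chain rule: [G] composed with the exponential has complex derivative [m = c * E], and
    multiplication by [m] gives the gradients [(re m, - im m)] and [(im m, re m)]. *)
Lemma log_coordinates_cauchy_riemann G x y :
  derivable (G : R[i]^o -> R[i]^o) (expc x y) 1 ->
  exists a b c : R, diff2 (fun x y => re (G (expc x y))) x y a b /\
                diff2 (fun x y => im (G (expc x y))) x y c a.
Proof.
move=> /complex_expansion[c cP]; pose E := expc x y; pose m := c * E.
have nE := normc_ge0 E; have nc := normc_ge0 c.
have key e : 0 < e -> exists2 d, 0 < d & forall x' y',
    `|x' - x| <= d -> `|y' - y| <= d ->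
    normc (G (expc x' y') - G E - m * ((x' - x) +i* (y' - y)))
      <= e * (`|x' - x| + `|y' - y|).
  move=> e0; pose K := normc E + normc c + 1.
  have K0 : 0 < K by rewrite /K; lra.
  have e1 : 0 < e / (2 * K) by rewrite divr_gt0// mulr_gt0.
  have e2 : 0 < Num.min 1 (e / (2 * K)) by rewrite lt_min ltr01.
  have [d1 d10 d1P] := cP _ e1; have [d2 d20 d2P] := expc_expansion x y _ e2.
  (* Increments of at most [d1 / (2 * K)] keep the exponential within [d1] of [E], because it moves
     by at most [K] times their sum. *)
  exists (Num.min d2 (d1 / (2 * K))).
    by rewrite lt_min d20 divr_gt0// mulr_gt0.
  move=> x' y'; rewrite !le_min => /andP[x2 x1] /andP[y2 y1].
  set E' := expc x' y'; set v := _ +i* _; set s := `|x' - x| + `|y' - y|.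
  have s0 : 0 <= s by rewrite /s addr_ge0.
  have vs : normc v <= s := normc_le_ReIm v.
  have := d2P x' y' x2 y2; rewrite -/E -/E' -/v -/s => hE.
  have hE1 : normc (E' - E - E * v) <= s.
    by rewrite (le_trans hE)// ler_piMl// ge_min lexx.
  have hE2 : normc (E' - E - E * v) <= e / (2 * K) * s.
    by rewrite (le_trans hE)// ler_wpM2r// ge_min lexx orbT.
  have nEE : normc (E' - E) <= K * s.
    rewrite -(subrK (E * v) (E' - E)) (le_trans (le_normcD _ _))// normcM.
    have : normc E * normc v <= normc E * s by rewrite ler_wpM2l.
    have : 0 <= normc c * s by rewrite mulr_ge0.
    by rewrite /K; lra.
  have Ed : normc (E' - E) <= d1.
    rewrite (le_trans nEE)// mulrC -ler_pdivlMr//.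
    have -> : d1 / K = d1 / (2 * K) + d1 / (2 * K) by field; rewrite gt_eqF.
    exact: lerD.
  have -> : G E' - G E - m * v = (G E' - G E - c * (E' - E)) + c * (E' - E - E * v).
    by rewrite /m; ring.
  rewrite (le_trans (le_normcD _ _))// normcM (le_trans (lerD (d1P _ Ed) (lexx _)))//.
  have A : e / (2 * K) * normc (E' - E) <= e / (2 * K) * (K * s).
    by rewrite ler_wpM2l// ltW.
  have B : normc c * normc (E' - E - E * v) <= K * (e / (2 * K) * s).
    by apply: ler_pM => //; [exact: normc_ge0|rewrite /K; lra].
  apply: le_trans (lerD A B) _; rewrite le_eqVlt; apply/orP; left; apply/eqP.
  by field; rewrite gt_eqF.
exists (re m), (- im m), (im m); split=> e /key[d d0 dP]; exists d => // x' y' xd yd;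
  apply: le_trans (dP x' y' xd yd).
- apply: le_trans (normRe_le _); rewrite le_eqVlt; apply/orP; left; apply/eqP.
  rewrite -/E; case: (G (expc x' y')) (G E) (m) => [? ?] [? ?] [? ?]; congr `|_|.
  by simpc => /=; ring.
- apply: le_trans (normIm_le _); rewrite le_eqVlt; apply/orP; left; apply/eqP.
  rewrite -/E; case: (G (expc x' y')) (G E) (m) => [? ?] [? ?] [? ?]; congr `|_|.
  by simpc => /=; ring.
Qed.

End complex_log_coordinates.

(** * The mean value property *)

Section mean_value.
Context {R : realType}.
Notation mu := (@lebesgue_measure R).
Variable G : R[i] -> R[i].
Hypothesis derG : forall z, normc z < 1 -> derivable (G : R[i]^o -> R[i]^o) z 1.

Let U (s t : R) : R := re (G (expc s t)).

Let V (s t : R) : R := im (G (expc s t)).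

Let cauchy_riemann_neg s t : s < 0 ->
  exists a b c, diff2 U s t a b /\ diff2 V s t c a.
Proof.
move=> s0; apply/log_coordinates_cauchy_riemann/derG.
by rewrite normc_expc -expR0 ltr_expR.
Qed.

Lemma circle_continuous s : s < 0 -> continuous (fun t => re (G (expc s t))).
Proof.
move=> s0 t; have [? [? [? [h _]]]] := cauchy_riemann_neg s t s0.
exact: diff2_continuous h.
Qed.

Lemma circle_mean_constant s0 s : s0 <= s -> s < 0 ->
  \int[mu]_(t in `[0, 2 * pi]) re (G (expc s t)) =
  \int[mu]_(t in `[0, 2 * pi]) re (G (expc s0 t)).
Proof.
move=> s0s sneg.
have pi0 : 0 <= 2 * pi :> R by rewrite mulr_ge0// pi_ge0.
have CR x y : s0 <= x <= s -> 0 <= y <= 2 * pi ->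
    exists a b c, diff2 U x y a b /\ diff2 V x y c a.
  by move=> /andP[_ xs] _; apply: cauchy_riemann_neg; exact: le_lt_trans sneg.
have := goursat U V s0 s 0 (2 * pi) s0s pi0 CR.
rewrite /boundary_integral.
have -> : (fun x => V x (2 * pi)) = (fun x => V x 0).
  by apply/funext => x; rewrite /V /expc /expi mulr_natl cos2pi sin2pi cos0 sin0.
by rewrite (subrr (\int[mu]_(x in `[s0, s]) V x 0)) subr0; exact: subr0_eq.
Qed.

Lemma mean_value s : s < 0 ->
  \int[mu]_(t in `[0, 2 * pi]) re (G (expc s t)) = re (G 0) * (2 * pi).
Proof.
move=> sneg; have pi0 : 0 < 2 * pi :> R by rewrite mulr_gt0// pi_gt0.
apply/subr0_eq/normr0_eq0/eqP; rewrite eq_le normr_ge0 andbT.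
apply/ler_addgt0Pr => e e0; rewrite add0r.
have [|c cP] := @complex_expansion R G 0; first by apply: derG; rewrite normc0.
have [d d0 dP] := cP 1 ltr01.
pose K := normc c + 1; have K0 : 0 < K by rewrite ltr_wpDl// normc_ge0.
(* Tolerance 1 makes [K] a Lipschitz constant of [G] at 0; radius [r] then keeps [re G] within
   [e / (2 pi)] of its value there. *)
pose r := Num.min d (e / (2 * pi) / K).
have r0 : 0 < r by rewrite lt_min d0 !divr_gt0.
pose s0 := Num.min s (ln r).
have s0s : s0 <= s by rewrite ge_min lexx.
have Es0 : expR s0 <= r.
  by rewrite -[leRHS]lnK ?posrE// ler_expR ge_min lexx orbT.
rewrite (circle_mean_constant s0 s)//.
have := @Rintegral_near_cst R 0 (2 * pi) (fun t => re (G (expc s0 t))) (re (G 0))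
  (e / (2 * pi)) (ltW pi0).
rewrite subr0 divfK ?gt_eqF//; apply.
  by move=> t _; apply: circle_continuous; exact: le_lt_trans sneg.
move=> t _; have nE : normc (expc s0 t) <= r by rewrite normc_expc.
have := dP (expc s0 t); rewrite subr0 mul1r.
rewrite (le_trans nE) ?ge_min ?lexx// => /(_ isT) h.
have -> : re (G (expc s0 t)) - re (G 0) = re (G (expc s0 t) - G 0).
  by case: (G _) (G 0) => [? ?] [? ?].
rewrite (le_trans (normRe_le _))//.
rewrite -(subrK (c * expc s0 t) (_ - G 0)) (le_trans (le_normcD _ _))// normcM.
have : K * normc (expc s0 t) <= K * r by rewrite ler_pM2l.
have : K * r <= e / (2 * pi) by rewrite mulrC -ler_pdivlMr// ge_min lexx orbT.
by move: h; rewrite /K; lra.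
Qed.

Lemma level_set_measurable (s k : R) : s < 0 ->
  measurable (`[0, 2 * pi[ `&` [set t | k <= re (G (expc s t))]).
Proof.
move=> s0; apply: measurableI => //.
rewrite (_ : [set t | _] = (fun t => re (G (expc s t))) @^-1` `[k, +oo[); last first.
  by apply/seteqP; split => t /=; rewrite in_itv/= andbT.
rewrite -[X in measurable X]setTI.
by apply: (continuous_measurable_fun (circle_continuous s s0)).
Qed.

(** Markov's inequality for the nonnegative function [re G] on the circle of radius [exp s], whose
    integral is known from the mean value property. *)
Lemma level_set_measure (s k : R) : s < 0 -> 0 < k ->
  (forall z, normc z < 1 -> 0 <= re (G z)) ->
  (k%:E * mu (`[0, 2 * pi[ `&` [set t | k <= re (G (expc s t))])%R
     <= (re (G 0) * (2 * pi))%:E)%E.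
Proof.
move=> s0 k0 G0; set A := _ `&` _.
have mA : measurable A by exact: level_set_measurable.
have Gs t : 0 <= re (G (expc s t)).
  by apply: G0; rewrite normc_expc -expR0 ltr_expR.
have mU D : measurable_fun D (fun t => re (G (expc s t))).
  apply: measurable_funTS.
  exact: continuous_measurable_fun (circle_continuous s s0).
have iU : mu.-integrable `[0, 2 * pi] (EFin \o (fun t => re (G (expc s t)))).
  by apply: cont_on_integrable => t _; exact: circle_continuous.
rewrite -(mean_value s s0) /Rintegral fineK; last exact: integrable_fin_num.
rewrite -integral_cst//.
apply: (@le_trans _ _ (\int[mu]_(t in A) (re (G (expc s t)))%:E)%E).
  apply: ge0_le_integral => //.
  - by move=> t _; rewrite lee_fin ltW.
  - by apply/measurable_EFinP; exact: mU.
  - by move=> t [_ /=]; rewrite lee_fin.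
apply: ge0_subset_integral => //.
- by apply/measurable_EFinP; exact: mU.
- by move=> t _; rewrite lee_fin.
- by move=> t [/=]; rewrite !in_itv/= => /andP[-> /ltW].
Qed.

End mean_value.

(** * The preimage of a disc about a boundary point *)

Lemma unit_discE {R : realType} (z : R[i]) : unit_disc z <-> normc z < 1.
Proof. by rewrite /unit_disc/= -ltcR. Qed.

Lemma normc_sqr {R : realType} (z : R[i]) : normc z ^+ 2 = re z ^+ 2 + im z ^+ 2.
Proof. by case: z => a b /=; rewrite sqr_sqrtr// addr_ge0// sqr_ge0. Qed.

Lemma normcB {R : realType} (z w : R[i]) : normc (z - w) = normc (w - z).
Proof. by rewrite -opprB normcN. Qed.

(** The product on the right equals [re (p * conj (p - f)) = |p| ^ 2 - re (p * conj f)], which is at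
    least [(1 + d) ^ 2 - (1 + d)], hence at least [d]. *)
Lemma re_pole_ge {R : realType} (p f : R[i]) (d : R) :
  0 < d -> normc p = 1 + d -> normc f < 1 ->
  d <= re (p / (p - f)) * normc (p - f) ^+ 2.
Proof.
move=> d0 np nf; have pf : p != f.
  by apply: contraTneq nf => <-; rewrite np -leNgt lerDl ltW.
have n0 : 0 < re (p - f) ^+ 2 + im (p - f) ^+ 2.
  rewrite -normc_sqr exprn_gt0// lt_neqAle normc_ge0 andbT eq_sym.
  by apply: contra pf => /eqP/eq0_normc/eqP; rewrite subr_eq0.
have E : re (p / (p - f)) * normc (p - f) ^+ 2 = re p * re (p - f) + im p * im (p - f).
  move: n0; rewrite normc_sqr; move: (p - f) => v; case: v => a b; case: (p) => c e /= n0.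
  by field; rewrite gt_eqF.
have := normc_sqr p; have := normc_sqr f; rewrite np {}E.
have nf2 : normc f ^+ 2 <= 1.
  by rewrite expr_le1 ?normc_ge0// ltW.
case: p f nf2 {np nf pf n0} => [a b] [c e] /= nf2 fE pE.
(* Cauchy-Schwarz for [re (p * conj f)], from [|p - (1 + d) f| ^ 2 >= 0]. *)
have h : 0 <= (a - (1 + d) * c) ^+ 2 + (b - (1 + d) * e) ^+ 2.
  by rewrite addr_ge0// sqr_ge0.
have l0 : 0 < 1 + d by lra.
have A : a * c + b * e <= 1 + d.
  rewrite -(@ler_pM2l _ (2 * (1 + d))) ?mulr_gt0//.
  have : (1 + d) ^+ 2 * (c ^+ 2 + e ^+ 2) <= (1 + d) ^+ 2.
    by apply: ler_piMr; [exact: sqr_ge0|rewrite -fE].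
  by move: h pE; rewrite !expr2; lra.
by move: A pE; rewrite !expr2; nra.
Qed.

Section boundary_preimage_cover.
Context {R : realType}.
Notation mu := (@lebesgue_measure R).
Variables (F : R[i] -> R[i]) (w0 : R[i]) (d : R).
Hypothesis F_self : holomorphic_self_map F.
Hypothesis F0 : F 0 = 0.
Hypothesis w01 : normc w0 = 1.
Hypothesis d0 : 0 < d.

Let p : R[i] := (1 + d)%:C * w0.

Let normp : normc p = 1 + d.
Proof.
rewrite normcM w01 mulr1 /= expr0n addr0 sqrtr_sqr ger0_norm// ltW//.
by rewrite addr_gt0.
Qed.

Let normF z : normc z < 1 -> normc (F z) < 1.
Proof. by case: F_self => _ h /unit_discE/h/unit_discE. Qed.

Let G (z : R[i]) : R[i] := p / (p - F z).

Let derG z : normc z < 1 -> derivable (G : R[i]^o -> R[i]^o) z 1.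
Proof.
move=> z1; have [dF _] := F_self.
have dFz : derivable (F : R[i]^o -> R[i]^o) z 1 by apply: dF; exact/unit_discE.
apply: (@derivableM _ _ (cst p : R[i]^o -> R[i]^o)); first exact: derivable_cst.
apply: (@derivableV _ _ (cst p - F : R[i]^o -> R[i]^o)).
  rewrite /= -[(_ - _) z]/(p - F z) subr_eq0; apply: contraTneq (normF z z1) => <-.
  by rewrite normp -leNgt lerDl ltW.
by apply: derivableB; [exact: derivable_cst|exact: dFz].
Qed.

Let Gge0 z : normc z < 1 -> 0 <= re (G z).
Proof.
move=> /normF/(re_pole_ge _ _ _ d0 normp) h.
have n0 : 0 < normc (p - F z) ^+ 2.
  rewrite lt_neqAle sqr_ge0 andbT; apply: contraTneq h => <-.
  by rewrite mulr0 -ltNge.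
by rewrite -(pmulr_lge0 _ n0) (le_trans _ h)// ltW.
Qed.

(** This is [d / (3 * d) ^ 2], the lower bound from [re_pole_ge] when [F z] lies within [3 * d] of
    the pole [p]. *)
Let level : R := (9 * d)^-1.

(** The radii [exp (- 1 / (k + 1))] increase to 1, so radial limits can be read off along them. *)
Let A k := `[0, 2 * pi[ `&` [set t | level <= re (G (expc (- k.+1%:R^-1) t))].

Let mA k : measurable (A k).
Proof.
apply: level_set_measurable; first exact: derG.
by rewrite oppr_lt0 invr_gt0.
Qed.

(** Since [G 0 = 1], the bound is [2 pi / level]. *)
Let muA k : (mu (A k) <= (18 * pi * d)%:E)%E.
Proof.
have k0 : - k.+1%:R^-1 < 0 :> R by rewrite oppr_lt0 invr_gt0.
have l0 : 0 < level by rewrite invr_gt0 mulr_gt0.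
have := level_set_measure G derG _ _ k0 l0 Gge0.
rewrite -/(A k) /G F0 subr0 divff; last first.
  by apply: contraTneq d0 => p0; move: normp; rewrite p0 normc0; lra.
rewrite -lee_pdivlMl// => /le_trans; apply.
by rewrite -EFinM lee_fin /level /=; lra.
Qed.

Lemma radial_limit_eventually t w : radial_limit F (expi t) w ->
  normc (w - w0) <= d -> t \in `[0, 2 * pi[ -> exists N, forall k, (N <= k)%N -> A k t.
Proof.
move=> Fw wd tI.
move: Fw => /(@cvgrPdist_le _ R[i]^o)/(_ d%:C).
rewrite ltcR => /(_ d0) [e /= e0 eP].
(* From this index on [1 / (k + 1) < e], and [1 - exp s <= - s] then puts the radius within [e] of
   1. *)
exists (Num.truncn e^-1) => k Nk; split=> //=.
set s := - _; have s0 : s < 0 by rewrite oppr_lt0 invr_gt0.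
have Es1 : expR s < 1 by rewrite -expR0 ltr_expR.
have ek : k.+1%:R^-1 < e.
  rewrite invf_plt ?posrE//.
  by apply: lt_le_trans (truncnS_gt _) _; rewrite ler_nat.
have := eP (expR s); rewrite /ball/= => /(_ _ Es1) h.
have {h} : normc (w - F (expc s t)) <= d.
  rewrite -lecR; apply: h; rewrite ger0_norm ?subr_ge0 ?ltW//.
  have := expR_ge1Dx s; rewrite {1}/s => hs.
  by rewrite ltrBlDr -ltrBlDl (lt_le_trans _ hs)// ltrD2l ltrN2.
move=> Fwd.
have nz : normc (expc s t) < 1 by rewrite normc_expc.
have h := re_pole_ge _ _ _ d0 normp (normF _ nz).
(* The steps from [p] to [w0], from [w0] to [w] and from [w] to the value of [F] have length at most
   [d] each. *)
have p3 : normc (p - F (expc s t)) <= 3 * d.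
  have -> : p - F (expc s t) = d%:C * w0 + ((w0 - w) + (w - F (expc s t))).
    by rewrite /p rmorphD rmorph1; ring.
  rewrite (le_trans (le_normcD _ _))// normcM w01 mulr1.
  rewrite (le_trans (lerD (lexx _) (le_normcD _ _)))// (normcB w0).
  have -> : normc d%:C = d by rewrite /= expr0n addr0 sqrtr_sqr gtr0_norm.
  lra.
have p9 : normc (p - F (expc s t)) ^+ 2 <= 9 * d ^+ 2.
  have -> : 9 * d ^+ 2 = (3 * d) ^+ 2 by ring.
  by rewrite lerXn2r// ?nnegrE ?normc_ge0// mulr_ge0// ltW.
rewrite /level -div1r ler_pdivrMr ?mulr_gt0// -(ler_pM2l d0) mulr1.
rewrite (le_trans (le_trans h (ler_wpM2l (Gge0 _ nz) p9)))//.
by rewrite -/(G _) le_eqVlt; apply/orP; left; apply/eqP; ring.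
Qed.

(** The cover is the lower limit of the sets [A k]: the tail intersections [B N] increase and lie in
    [A N], so continuity from below preserves the bound. A measurable cover is all that
    Borel-Cantelli asks for. *)
Lemma boundary_preimage_cover : exists E, [/\ measurable E,
  (mu E <= (18 * pi * d)%:E)%E & forall t w, t \in `[0, 2 * pi[ ->
    radial_limit F (expi t) w -> normc (w - w0) <= d -> E t].
Proof.
pose B N := \bigcap_(k in [set k | (N <= k)%N]) A k.
have mB N : measurable (B N).
  by apply: bigcap_measurable => //; exists N => /=.
exists (\bigcup_N B N); split.
- by apply: bigcup_measurable => N _; exact: mB.
- have ndB : nondecreasing_seq B.
    move=> m n mn; apply/subsetPset => t Bt k /= nk; apply: Bt => /=.
    exact: leq_trans nk.
  have mUB : measurable (\bigcup_N B N) by apply: bigcup_measurable => N _; exact: mB.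
  have cB : mu (B N) @[N --> \oo] --> mu (\bigcup_N B N).
    exact: nondecreasing_cvg_mu.
  rewrite -(cvg_lim _ cB)//; apply: lime_le; first exact: cvgP cB.
  apply: nearW => N /=; apply: le_trans (muA N).
  by apply: le_measure; rewrite ?inE; [exact: mB|exact: mA|move=> t; apply => /=].
- move=> t w tI Fw wd; have [N NP] := radial_limit_eventually t w Fw wd tI.
  by exists N.
Qed.

End boundary_preimage_cover.

(** * Arcs *)

Section arcs.
Context {R : realType}.
Notation mu := (@lebesgue_measure R).
Implicit Types (s t a b c l : R).

(** Monotonicity for arbitrary sets, from the outer measure; it applies to [angles A] without a
    proof that this set is measurable. *)
Lemma le_lebesgue_measure_outer (X Y : set R) : X `<=` Y -> (mu X <= mu Y)%E.
Proof.
rewrite /lebesgue_measure /lebesgue_stieltjes_measure /measure_extension.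
move=> XY; exact: (@le_mu_ext _ _ _ (wlength idfun) X Y XY).
Qed.

(** Each coordinate changes by at most [t - s]; the factor 2 comes from adding them. *)
Lemma normc_expi_chord s t : s <= t -> normc (expi t - expi s) <= 2 * (t - s).
Proof.
move=> st.
have [c _ cE] := @MVT_segment R (@cos R) (fun x => - sin x) s t st
  (fun x _ => is_derive_cos x) (continuous_subspaceT (@continuous_cos R)).
have [e _ eE] := @MVT_segment R (@sin R) (fun x => cos x) s t st
  (fun x _ => is_derive_sin x) (continuous_subspaceT (@continuous_sin R)).
have ts0 : 0 <= t - s by rewrite subr_ge0.
rewrite (le_trans (normc_le_ReIm _))//= cE eE !normrM normrN (ger0_norm ts0).
have c1 : `|sin c| * (t - s) <= 1 * (t - s).
  by rewrite ler_wpM2r// ler_norml sin_geN1 sin_le1.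
have e1 : `|cos e| * (t - s) <= 1 * (t - s).
  by rewrite ler_wpM2r// ler_norml cos_geN1 cos_le1.
lra.
Qed.

Lemma expiD2pi t : expi (t + 2 * pi) = expi t.
Proof. by rewrite mulr_natl /expi cosD2pi sinD2pi. Qed.

Lemma expiD2pi_int t (k : int) : expi (t + k%:~R * (2 * pi)) = expi t.
Proof.
elim/int_rect: k t => [|n IH|n IH] t; first by rewrite mul0r addr0.
- by rewrite intS rmorphD rmorph1 mulrDl mul1r addrA IH expiD2pi.
- rewrite intS opprD rmorphD rmorphN1 mulrDl mulN1r addrA IH.
  by rewrite -[LHS]expiD2pi addrNK.
Qed.

Lemma expi_reduction a : exists c,
  0 <= a + c < 2 * pi /\ forall t, expi (t + c) = expi t.
Proof.
have pi0 : 0 < 2 * pi :> R by rewrite mulr_gt0// pi_gt0.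
pose k := Num.floor (a / (2 * pi)).
exists ((- k)%:~R * (2 * pi)); split; last by move=> t; exact: expiD2pi_int.
rewrite rmorphN mulNr subr_ge0 ltrBlDl -ler_pdivlMr// real_floor_le ?num_real//=.
by rewrite -{2}(mul1r (2 * pi)) -mulrDl -ltr_pdivrMr// -intrD1 real_floorD1_gt ?num_real.
Qed.

(** Arc length only counts angles in [[0, 2 pi[], so an interval that crosses [2 pi] after reduction
    is cut there. Each of the two pieces has chord at most twice the arc length, hence the factor
    4. *)
Lemma arc_chord (J : set R) a b : is_interval J -> J a -> J b -> a <= b ->
  ((normc (expi b - expi a))%:E <= 4%:E * arc_length (@expi R @` J))%E.
Proof.
move=> iJ Ja Jb ab; set A := _ @` J.
have [c [/andP[a0 a2] cE]] := expi_reduction a.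
have pi0 : 0 < 2 * pi :> R by rewrite mulr_gt0// pi_gt0.
have inA t : a + c <= t <= b + c -> A (expi t).
  move=> tab; exists (t - c); first by apply: (iJ a b) => //; lra.
  by rewrite -cE subrK.
have L0 : (0 <= arc_length A)%E by exact: measure_ge0.
have angle u v : 0 <= u -> u <= v -> v <= 2 * pi ->
    (forall t, u <= t < v -> A (expi t)) -> ((v - u)%:E <= arc_length A)%E.
  move=> u0 uv v2 h.
  have := @le_lebesgue_measure_outer `[u, v[ (angles A).
  rewrite lebesgue_measure_itv/= lte_fin; case: ltgtP uv => // [uv|->] _; last first.
    by move=> _; rewrite subrr.
  rewrite -EFinB; apply => t /=; rewrite in_itv/= => /andP[ut tv]; split.
    by rewrite /= in_itv/= (le_trans u0 ut) (lt_le_trans tv v2).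
  by apply: h; rewrite ut.
rewrite -(cE a) -(cE b).
have [b2|b2] := leP (b + c) (2 * pi).
  have h : ((b + c - (a + c))%:E <= arc_length A)%E.
    apply: angle => //; first lra.
    by move=> t /andP[t1 t2]; apply: inA; rewrite t1 ltW.
  have abc : a + c <= b + c by lra.
  apply: (@le_trans _ _ (2%:E * arc_length A)%E).
    rewrite (le_trans _ (lee_wpmul2l _ h))// -EFinM lee_fin.
    exact: normc_expi_chord.
  by rewrite lee_wpmul2r// lee_fin; lra.
have h1 : ((2 * pi - (a + c))%:E <= arc_length A)%E.
  apply: angle => //; first exact: ltW.
  by move=> t /andP[t1 t2]; apply: inA; rewrite t1 ltW// (lt_trans t2).
(* The cap 1 keeps [[0, v[] inside [[0, 2 pi[] however long the interval is; when it is attained,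
   the chord is still at most [2 = 2 * v]. *)
pose v := Num.min (b + c - 2 * pi) 1.
have v0 : 0 < v by rewrite lt_min ltr01 andbT subr_gt0.
have h2 : ((v - 0)%:E <= arc_length A)%E.
  apply: angle => //; first exact: ltW.
    rewrite (@le_trans _ _ 1)// ?ge_min ?lexx ?orbT//.
    have := @pi_ge2 R; lra.
  move=> t /andP[t1]; rewrite lt_min => /andP[t2 _].
  by rewrite -(expiD2pi t); apply: inA; lra.
have p1 : expi (2 * pi) = expi 0 :> R[i] by rewrite -(expiD2pi 0) add0r.
have H1 : normc (expi (2 * pi) - expi (a + c)) <= 2 * (2 * pi - (a + c)).
  by apply: normc_expi_chord; lra.
have H2 : normc (expi (b + c) - expi (2 * pi)) <= 2 * v.
  have [le1|lt1] := leP (b + c - 2 * pi) 1.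
    rewrite /v (min_idPl le1); apply: normc_expi_chord; lra.
  rewrite /v (min_idPr (ltW lt1)) mulr1.
  by rewrite (le_trans (le_normcD _ _))// normcN !normc_expi; lra.
have -> : expi (b + c) - expi (a + c) =
    (expi (b + c) - expi (2 * pi)) + (expi (2 * pi) - expi (a + c)) by ring.
apply: (@le_trans _ _ (2 * (v - 0) + 2 * (2 * pi - (a + c)))%:E).
  by rewrite lee_fin (le_trans (le_normcD _ _))//; lra.
have -> : (4%:E * arc_length A = 2%:E * arc_length A + 2%:E * arc_length A)%E.
  by rewrite -ge0_muleDl ?lee_fin// -EFinD; congr (_ %:E * _)%E; lra.
by rewrite EFinD !EFinM leeD// lee_wpmul2l// lee_fin.
Qed.

Lemma arc_diameter (A : set R[i]) z w : is_arc A -> A z -> A w ->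
  ((normc (z - w))%:E <= 4%:E * arc_length A)%E.
Proof.
move=> [J [iJ _ ->]] [a Ja <-] [b Jb <-].
have [ab|/ltW ba] := leP a b; last exact: arc_chord.
by rewrite normcB; exact: arc_chord.
Qed.

End arcs.

(** * Conclusion by the Borel-Cantelli lemma *)

Theorem theoremA (R : realType) (F : nat -> R[i] -> R[i])
    (I : nat -> set R[i])
    (F_self : forall n, holomorphic_self_map (F n))
    (F0 : forall n, F n 0 = 0)
    (I_shrinking : shrinking_target I)
    (I_summable : (\sum_(0 <= n <oo) arc_length (I n) < +oo)%E) :
  almost_all_circle (fails_to_hit F I).
Proof.
have [arcI _] := I_shrinking.
have L0 n : (0 <= arc_length (I n))%E by exact: measure_ge0.
pose l n := fine (arc_length (I n)).
have lE n : arc_length (I n) = (l n)%:E.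
  rewrite fineK// ge0_fin_numE//; apply: le_lt_trans I_summable.
  by rewrite (@nneseriesD1 _ _ n)// leeDl// nneseries_ge0.
have l0 n : 0 <= l n by rewrite -lee_fin -lE.
(* The geometric term keeps the radius positive when an arc is a single point. *)
pose d n := 4 * l n + 1 / (2 ^ (n + 1))%:R.
have d0 n : 0 < d n by rewrite ltr_wpDl ?mulr_ge0// divr_gt0// ltr0n expn_gt0.
have /choice[E EP] : forall n, exists E, [/\ measurable E,
    (lebesgue_measure E <= (18 * pi * d n)%:E)%E &
    forall t, t \in `[0, 2 * pi[ -> boundary_preimage (F n) (I n) (expi t) -> E t].
  move=> n; have [J [iJ [a Ja] IE]] := arcI n.
  have Ia : I n (expi a) by rewrite IE; exists a.
  (* Any point of the nonempty arc serves as centre: the arc has diameter at most [4 * l n], so the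
     disc of radius [d n] contains it. *)
  have [E [mE muE EP]] := boundary_preimage_cover (F n) (expi a) (d n)
    (F_self n) (F0 n) (normc_expi a) (d0 n).
  exists E; split=> // t tI [_ [w Fw Iw]]; apply: (EP t w tI Fw).
  have := arc_diameter _ _ _ (arcI n) Iw Ia.
  rewrite lE -EFinM lee_fin => /le_trans; apply.
  by rewrite lerDl divr_ge0.
(* The exceptional angles lie in the upper limit of the covers, which is measurable, and null by
   Borel-Cantelli. *)
exists (lim_sup_set E); split.
- apply: bigcap_measurable => // k _; apply: bigcup_measurable => j _.
  by have [] := EP j.
- apply: lim_sup_set_cvg0 => [n|]; first by have [] := EP n.
  apply: (@le_lt_trans _ _ (\sum_(0 <= n <oo) (18 * pi * d n)%:E)%E).
    apply: lee_nneseries => n _; first by rewrite measure_ge0.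
    by have [] := EP n.
  have pi18 : 0 <= 18 * pi :> R by rewrite mulr_ge0// pi_ge0.
  (* The series splits into a multiple of the summable arc lengths and a multiple of a geometric
     series. *)
  under eq_eseriesr do rewrite /d mulrDr mulrA EFinD.
  rewrite nneseriesD; last 2 first.
  - by move=> n _ _; rewrite lee_fin mulr_ge0// mulr_ge0.
  - by move=> n _ _; rewrite lee_fin mulr_ge0// divr_ge0.
  apply: lte_add_pinfty.
    under eq_eseriesr do rewrite EFinM -lE.
    rewrite nneseriesZl//; apply: lte_mul_pinfty => //; first by rewrite lee_fin mulr_ge0.
  under eq_eseriesr do rewrite EFinM.
  rewrite nneseriesZl; last by move=> n _; rewrite lee_fin divr_ge0.
  have /cvg_lim H := @cvg_geometric_eseries_half R 1 0.
  by rewrite [X in (_ * X)%E]H// -EFinM ltry.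
(* At an exceptional angle the target is hit, so the angle lies in infinitely many of the covers. *)
move=> t /= /not_implyP[tI /contrapT h] N _.
have [k Nk kt] := h N Logic.I.
by exists k => //; have [_ _] := EP k; apply.
Qed.
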